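(* Let $P=[n_1]+[n_2]+\cdots+[n_k]$ be a disjoint union of chains on $[n]$, $n=n_1+\cdots+n_k$, whose elements are labeled consecutively within chains (the $i$-th chain is $N_i+1\prec N_i+2\prec\cdots\prec N_i+n_i$ with $N_i=n_1+\cdots+n_{i-1}$). Let $M$ be the transition matrix of the promotion graph of $P$ with edge weights given by indeterminates $x_1,\dots,x_n$. Then $$\det(\lambda\mathbb{1}-M)=\lambda\prod_{\substack{\emptyset\subsetneq S\subseteq[n]\\ S\text{ lower set in }P}}(\lambda+x_S)^{\mathfrak{d}_S},$$ where $x_S=\sum_{i\in S}x_i$ and $\mathfrak{d}_S$ is the number of poset derangements of the restriction of $P$ to $S$.
   Context: $\mathcal{L}(P)=\{\pi\in S_n : i\prec j \Rightarrow \pi^{-1}_i<\pi^{-1}_j\}$, in one-line notation $\pi=\pi_1\cdots\pi_n$. $\pi\tau_i$ ($1\le i<n$) swaps $\pi_i,\pi_{i+1}$ if they are incomparable and is $\pi$ otherwise; operators act on the right; $\partial_j=\tau_j\cdots\tau_{n-1}$. Promotion graph: vertices $\mathcal{L}(P)$, an edge $\pi\to\pi\partial_j$ of weight $x_{\pi_j}$ for each $\pi$, $j\in[n]$. Transition matrix $M$: for $\pi'\ne\pi$, $M(\pi',\pi)$ is the sum of weights of edges $\pi\to\pi'$; $M(\pi,\pi)$ is minus the sum of weights of edges $\pi\to\pi'$ with $\pi'\ne\pi$. A lower set $S$ satisfies $x\in S,\ y\preceq x\Rightarrow y\in S$. A poset derangement of a poset $Q$ labeled by $[m]$ is a linear extension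 $\pi$ of $Q$ with $\pi_j\ne j$ for all $j$. For a lower set $S$, the restriction $P|_S$ is relabeled by $[|S|]$ via the unique order-preserving bijection of integer labels $S\to[|S|]$ (it is again a union of chains labeled consecutively within chains), and $\mathfrak{d}_S$ is its number of poset derangements. *)

(* Defs.v *)
From HB Require Import structures.
From mathcomp Require Import all_boot all_order all_algebra all_fingroup.
From mathcomp Require Import mpoly.
Set Implicit Arguments. Unset Strict Implicit. Unset Printing Implicit Defensive.
Import GRing.Theory.
Local Open Scope ring_scope.

(* Elements of [n] are represented 0-based by 'I_n; positions in one-line
   notation are 0-based too.  A permutation p : 'S_n is read in one-line
   notation as pi_(j+1) = p j + 1. *)

Definition linext_rel (m : nat) (r : rel 'I_m) (p : 'S_m) : bool :=
  [forall i : 'I_m, forall j : 'I_m, r i j ==> ((p^-1)%g i < (p^-1)%g j)%N].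

Definition poset_derangement (m : nat) (r : rel 'I_m) (p : 'S_m) : bool :=
  linext_rel r p && [forall j : 'I_m, p j != j].

Section Chains.
Variable ns : seq nat.
Local Notation n := (sumn ns).

Definition chain_start (i : nat) : nat := sumn (take i ns).

Definition in_chain (i x : nat) : bool :=
  (chain_start i <= x)%N && (x < chain_start i.+1)%N.

Definition prec (x y : 'I_n) : bool :=
  has (fun i => in_chain i x && in_chain i y) (iota 0 (size ns)) && (x < y)%N.

Definition comparable (x y : 'I_n) : bool := prec x y || prec y x.

Definition linexts : {set 'S_n} := [set p | linext_rel prec p].

(** tau_i acting on the right (0-based: swaps positions i and i+1). *)
Definition tau (i : nat) (p : 'S_n) : 'S_n :=
  match @insub _ (fun k => k < n)%N _ i, @insub _ (fun k => k < n)%N _ i.+1 with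
  | Some a, Some b =>
      let a' : 'I_n := a in let b' : 'I_n := b in
      if comparable (p a') (p b') then p else (tperm a' b' * p)%g
  | _, _ => p
  end.

(** partial_{j+1} = tau_{j+1} ... tau_{n-1}  (1-based), applied left to right. *)
Definition promo (j : nat) (p : 'S_n) : 'S_n :=
  foldl (fun q k => tau k q) p (iota j (n.-1 - j)).

(** Transition matrix M of the promotion graph, indexed by linear extensions
    (in the order of enum linexts). Column = source pi, row = target pi'. *)
Definition trans_entry (p' p : 'S_n) : {mpoly int[n]} :=
  if p' != p then \sum_(j : 'I_n | promo j p == p') 'X_(p j)
  else - \sum_(j : 'I_n | promo j p != p) 'X_(p j).

Definition transM : 'M[{mpoly int[n]}]_(#|linexts|) :=
  \matrix_(a, b) trans_entry (enum_val a) (enum_val b).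

Definition lower_set (S : {set 'I_n}) : bool :=
  [forall x : 'I_n, forall y : 'I_n, (prec y x && (x \in S)) ==> (y \in S)].

Definition xS (S : {set 'I_n}) : {mpoly int[n]} := \sum_(i in S) 'X_i.

Definition relabel (S : {set 'I_n}) (x : 'I_n) : nat := #|[set y in S | (y < x)%N]|.

Definition restr_rel (S : {set 'I_n}) (a b : 'I_#|S|) : bool :=
  [exists x : 'I_n, exists y : 'I_n,
    [&& x \in S, y \in S, relabel S x == a, relabel S y == b & prec x y]].

Definition dS (S : {set 'I_n}) : nat :=
  #|[set p : 'S_#|S| | @poset_derangement #|S| (@restr_rel S) p]|.

End Chains.

(* Main.v *)
(** Record a linear extension by its word of chain indices, read from the end:
    promotion becomes moving a letter to the front, weighted by the position of
    that letter among the occurrences of its colour.  Let [chi_N] be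
    [det (lam - T)] for the resulting operator [T] on the functions of words of
    content [N], and let [y_N] be the total weight.  The functions depending
    only on the first [k] letters are stable under the walk, and Sylvester's
    determinant identity compares the determinants on prefixes of lengths
    [k + 1] and [k].  Telescoping over [k] shows that
    [Psi_N := \prod_(U <= N) chi_U] satisfies
    [Psi_N = (lam - y_N) * \prod_(a | 0 < N a) Psi_(N - e_a)], whence
    [Psi_N = \prod_(U <= N) (lam - y_U) ^ nwords (N - U)], where [nwords M] is
    the number of words of content [M].  Erasing the fixed points of a linear
    extension leaves a derangement from which it can be recovered, so
    [nwords M = \sum_(U <= M) der U]; cancelling by induction on [N] gives
    [chi_N = \prod_(U <= N) (lam - y_U) ^ der (N - U)].  The lower sets are in
    bijection with the vectors [N - U], and [lam = 'X + y_N] turns [lam - y_U]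
    into ['X + x_S]. *)
Require Import Defs.
From HB Require Import structures.
From mathcomp Require Import all_boot all_order all_algebra all_fingroup.
From mathcomp Require Import mpoly zify ring.
Import GRing.Theory.
Local Open Scope ring_scope.
Set Implicit Arguments. Unset Strict Implicit. Unset Printing Implicit Defensive.

(** * Determinants of matrices indexed by sequences *)

Section SeqMatrix.
Variable R : comNzRingType.

(** Indexing by sequences lets an index set be permuted, split or mapped as a sequence; casts of
    dimensions are handled by [mxS_cast]. *)
Definition mxS (T T' : Type) (s : seq T) (t : seq T') (F : T -> T' -> R) :
  'M[R]_(size s, size t) :=
  \matrix_(i, j) F (tnth (in_tuple s) i) (tnth (in_tuple t) j).

Definition detS (T : Type) (s : seq T) (F : T -> T -> R) : R := \det (mxS s s F).

Lemma eq_mxS (T T' : eqType) (s : seq T) (t : seq T') F G :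
  {in s & t, forall x y, F x y = G x y} -> mxS s t F = mxS s t G.
Proof. by move=> e; apply/matrixP => i j; rewrite !mxE e // mem_tnth. Qed.

Lemma eq_detS (T : eqType) (s : seq T) F G :
  {in s &, forall x y, F x y = G x y} -> detS s F = detS s G.
Proof. by move=> e; rewrite /detS (eq_mxS e). Qed.

Lemma mul_mxS (T1 T2 T3 : Type) (s1 : seq T1) (s2 : seq T2) (s3 : seq T3) F G :
  mxS s1 s2 F *m mxS s2 s3 G = mxS s1 s3 (fun x z => \sum_(y <- s2) F x y * G y z).
Proof.
apply/matrixP => i j; rewrite !mxE [RHS]big_tnth.
by apply: eq_bigr => k _; rewrite !mxE.
Qed.

Lemma add_mxS (T T' : Type) (s : seq T) (t : seq T') F G :
  mxS s t F + mxS s t G = mxS s t (fun x y => F x y + G x y).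
Proof. by apply/matrixP => i j; rewrite !mxE. Qed.

Lemma opp_mxS (T T' : Type) (s : seq T) (t : seq T') F :
  - mxS s t F = mxS s t (fun x y => - F x y).
Proof. by apply/matrixP => i j; rewrite !mxE. Qed.

Lemma detS_nil (T : Type) (F : T -> T -> R) : detS [::] F = 1.
Proof. exact: det_mx00. Qed.

Lemma detS_seq1 (T : Type) (x : T) (F : T -> T -> R) : detS [:: x] F = F x x.
Proof. by rewrite /detS det_mx11 mxE. Qed.

Lemma mxS_cast (T : Type) (s : seq T) m (e : size s = m) (x0 : T) F :
  \det (\matrix_(i < m, j < m) F (nth x0 s i) (nth x0 s j)) = detS s F.
Proof.
case: m / e; congr (\det _); apply/matrixP => i j; rewrite !mxE.
by rewrite !(tnth_nth x0).
Qed.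

Lemma detS_map (T T' : Type) (f : T -> T') (s : seq T) (F : T' -> T' -> R) :
  detS (map f s) F = detS s (fun x y => F (f x) (f y)).
Proof.
case: s => [|x0 s]; first by rewrite !detS_nil.
rewrite -(mxS_cast (size_map f _) (f x0)); congr (\det _).
by apply/matrixP => i j; rewrite !mxE !(nth_map x0) // !(tnth_nth x0).
Qed.

Lemma detS_tr (T : Type) (s : seq T) (F : T -> T -> R) :
  detS s F = detS s (fun x y => F y x).
Proof. by rewrite /detS -det_tr; congr (\det _); apply/matrixP => i j; rewrite !mxE. Qed.

Lemma detS_cat (T : eqType) (s t : seq T) (F : T -> T -> R) :
  {in s & t, forall x y, F x y = 0} -> detS (s ++ t) F = detS s F * detS t F.
Proof.
case: s => [|x0 s] F0; first by rewrite detS_nil mul1r.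
rewrite -(mxS_cast (size_cat _ _) x0).
move: (x0 :: s) F0 => s' F0.
rewrite -(det_lblock (mxS s' s' F) (mxS t s' F) (mxS t t F)).
congr (\det _); apply/matrixP => i j; rewrite mxE.
case: (split_ordP i) => i' -> /=; case: (split_ordP j) => j' -> /=.
- by rewrite block_mxEul mxE !(tnth_nth x0) !nth_cat !ltn_ord.
- rewrite block_mxEur mxE !nth_cat ltn_ord ltnNge leq_addr /= addKn.
  by apply: F0; rewrite mem_nth.
- by rewrite block_mxEdl mxE !(tnth_nth x0) !nth_cat ltn_ord ltnNge leq_addr /= addKn.
- by rewrite block_mxEdr mxE !(tnth_nth x0) !nth_cat !ltnNge !leq_addr /= !addKn.
Qed.

Lemma detS_perm (T : eqType) (s t : seq T) (F : T -> T -> R) :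
  perm_eq s t -> detS s F = detS t F.
Proof.
move=> st; have e := perm_size st; rewrite perm_sym in st.
case: s st e => [|x0 s]; first by move=> _ /esym/size0nil ->.
set s' := x0 :: s => st e.
have /tuple_permP[p tE] : perm_eq t (in_tuple s') by [].
rewrite -(mxS_cast (esym e) x0).
have -> : \matrix_(i < size s', j < size s') F (nth x0 t i) (nth x0 t j) =
          row_perm p (col_perm p (mxS s' s' F)).
  apply/matrixP => i j; rewrite !mxE.
  have H (k : 'I_(size s')) : nth x0 t k = tnth (in_tuple s') (p k).
    rewrite [in LHS]tE -tnth_nth tnth_map tnth_ord_tuple //.
  by rewrite !H.
rewrite row_permE col_permE !det_mulmx !det_perm mulrA.
by rewrite odd_permV mulrAC -signr_addb addbb mul1r.
Qed.

(** Sorting the index set by key makes the matrix block diagonal. A key that does not occur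
    contributes an empty determinant, equal to 1. *)
Lemma detS_blocks (T U : eqType) (key : T -> U) (ks : seq U) (s : seq T)
    (F : T -> T -> R) :
  uniq ks -> {in s, forall x, key x \in ks} ->
  {in s &, forall x y, key x != key y -> F x y = 0} ->
  detS s F = \prod_(k <- ks) detS [seq x <- s | key x == k] F.
Proof.
elim: ks s => [|k ks IH] s /=.
  case: s => [|x s] _ H; first by rewrite big_nil detS_nil.
  by have := H x (mem_head _ _).
move=> /andP[kks uks] Hk HF; rewrite big_cons.
rewrite -(detS_perm _ (permEl (perm_filterC (fun x => key x == k) s))) detS_cat; last first.
  move=> x y; rewrite !mem_filter => /andP[/eqP kx xs] /andP[/= ky ys].
  by apply: HF; rewrite // kx eq_sym.
congr (_ * _); rewrite IH //; first last.
- by move=> x y; rewrite !mem_filter => /andP[_ xs] /andP[_ ys]; apply: HF.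
- move=> x; rewrite mem_filter => /andP[/= kx xs].
  by have := Hk x xs; rewrite inE (negPf kx).
apply: eq_big_seq => l lks; rewrite -filter_predI; congr (detS _ F).
apply: eq_filter => x /=; case: eqP => //= ->.
by apply: contraNneq kks => <-.
Qed.

(** Both sides are the determinant of [M]: the same unipotent factor clears its top right block from
    the left trivially, and from the right thanks to the intertwining hypothesis. *)
Lemma sylvester m l (A : 'M[R]_m) (B : 'M[R]_l) (I : 'M_(m, l)) (Q : 'M_(l, m)) :
  A *m I = I *m B ->
  \det (A - I *m Q) * \det B = \det A * \det (B - Q *m I).
Proof.
move=> AI; pose M := block_mx A (I *m B) Q B.
have M1 : block_mx 1%:M (- I) 0 1%:M *m M = block_mx (A - I *m Q) 0 Q B.
  by rewrite /M mulmx_block !mul1mx !mul0mx !mulNmx !add0r subrr.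
have M2 : M *m block_mx 1%:M (- I) 0 1%:M = block_mx A 0 Q (B - Q *m I).
  by rewrite /M mulmx_block !mulmx1 !mulmx0 !mulmxN !addr0 AI addNr [in RHS]addrC.
by rewrite -(det_lblock _ Q) -(det_lblock A Q) -M1 -M2 !det_mulmx mulrC det_ublock !det1 !mul1r.
Qed.

End SeqMatrix.

(** * Words of bounded content *)

(* There is one colour more than there are chains: ['I_K.+1] then provides a
   default letter, and the extra colour never occurs. *)
Section Words.
Variable (K : nat).
Local Notation color := 'I_K.+1.
Local Notation word := (seq color).

Definition step (r : word) (p : nat) : word :=
  nth ord0 r p :: take p r ++ drop p.+1 r.

Lemma perm_step r p : (p < size r)%N -> perm_eq (step r p) r.
Proof.
move=> pr; rewrite -[X in perm_eq _ X](cat_take_drop p) (drop_nth ord0 pr).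
by rewrite /step -cat1s perm_catCA.
Qed.

Lemma step_rcons u a p : (p < size u)%N -> step (rcons u a) p = rcons (step u p) a.
Proof.
move=> pu; rewrite /step nth_rcons pu rcons_cons -!cats1 take_cat pu drop_cat.
case: ltnP => h; first by rewrite /= catA.
have -> : (p.+1 - size u = 0)%N by lia.
by rewrite drop0 [drop p.+1 u]drop_oversize ?cats0.
Qed.

Lemma step_rcons_last u a : step (rcons u a) (size u) = a :: u.
Proof.
rewrite /step nth_rcons ltnn eqxx -cats1 take_size_cat // drop_oversize ?cats0 //.
by rewrite size_cat addn1.
Qed.

Section Boxes.
Variable B : nat.
Local Notation vec := {ffun color -> 'I_B.+1}.
Implicit Types (N U W M : vec) (k : nat) (a c : color) (u v x : word).

Definition weight (N : vec) : nat := (\sum_c N c)%N.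
Definition lev (U N : vec) := [forall c, (U c <= N c)%N].
Definition subv (N U : vec) : vec :=
  [ffun c => Ordinal (leq_ltn_trans (leq_subr (U c) (N c)) (ltn_ord (N c)))].
Definition decv (N : vec) (a : color) : vec :=
  [ffun c => Ordinal (leq_ltn_trans (leq_subr (c == a) (N c)) (ltn_ord (N c)))].

(** For [k] at most [weight N], these are the prefixes of length [k] of the words of content [N]. *)
Definition words (N : vec) (k : nat) : seq word :=
  [seq u <- [seq val t | t <- enum {: k.-tuple color}] |
     [forall c, (count_mem c u <= N c)%N]].

Lemma mem_words N k u :
  (u \in words N k) = (size u == k) && [forall c, (count_mem c u <= N c)%N].
Proof.
rewrite /words mem_filter [LHS]andbC; congr andb.
apply/mapP/eqP => [[t _ ->]|su]; first by rewrite size_tuple.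
by exists (tcast su (in_tuple u)); [rewrite mem_enum|rewrite -[RHS]/(tval _) val_tcast].
Qed.

Lemma words_uniq N k : uniq (words N k).
Proof. by rewrite filter_uniq // map_inj_uniq ?enum_uniq //; apply: val_inj. Qed.

Lemma perm_words N k u v : perm_eq u v -> (u \in words N k) = (v \in words N k).
Proof.
move=> uv; rewrite !mem_words (perm_size uv); congr (_ && _).
by apply: eq_forallb => c; rewrite (seq.permP uv).
Qed.

Lemma weight_dec N a : (0 < N a)%N -> (weight (decv N a)).+1 = weight N.
Proof.
move=> Na; rewrite /weight (bigD1 a) // [in RHS](bigD1 a) //= ffunE /= eqxx.
rewrite -addSn -subSn // subn1 /=; congr (_ + _)%N.
by apply: eq_bigr => c /negPf ca; rewrite ffunE /= ca subn0.
Qed.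

Lemma size_count (u : word) : size u = (\sum_c count_mem c u)%N.
Proof.
elim: u => [|x u IH] /=; first by rewrite big1.
rewrite big_split /= -IH (bigD1 x) //= eqxx big1 ?addn0 // => c.
by rewrite eq_sym => /negPf ->.
Qed.

Lemma words_full N k u : (u \in words N k) -> k = weight N ->
  forall c, count_mem c u = N c.
Proof.
rewrite mem_words => /andP[/eqP su /forallP le] kN c; apply/eqP.
rewrite eqn_leq le /= leqNgt; apply/negP => lt; move: su; apply/eqP.
rewrite kN size_count neq_ltn /weight; apply/orP; left.
rewrite (bigD1 c) //= [ltnRHS](bigD1 c) //= -addSn leq_add //.
by apply: leq_sum => d _; apply: le.
Qed.

Lemma words_weight N k u :
  (forall c, count_mem c u = N c) -> k = weight N -> u \in words N k.
Proof.
move=> uN ->; rewrite mem_words size_count; apply/andP; split.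
  by apply/eqP; apply: eq_bigr => c _; rewrite uN.
by apply/forallP => c; rewrite uN.
Qed.

Lemma rcons_words N k u a :
  (rcons u a \in words N k.+1) = (0 < N a)%N && (u \in words (decv N a) k).
Proof.
rewrite !mem_words size_rcons eqSS andbCA; congr (_ && _).
apply/forallP/andP => [H|[Na /forallP H] c].
  split; first by have := H a; rewrite -cats1 count_cat /= eqxx; lia.
  by apply/forallP => c; have := H c; rewrite -cats1 count_cat ffunE /= eq_sym; lia.
by have := H c; rewrite -cats1 count_cat ffunE /= addn0 [a == c]eq_sym; have [->|_] := eqVneq c a; lia.
Qed.

Lemma cons_words N k u a :
  (a :: u \in words N k.+1) = (count_mem a u < N a)%N && (u \in words N k).
Proof.
rewrite !mem_words /= eqSS andbCA; congr (_ && _).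
apply/forallP/andP => [H|[Na /forallP H] c].
  split; first by have := H a; rewrite eqxx.
  by apply/forallP => c; apply: leq_trans (H c); rewrite leq_addl.
by have [<-//|] := eqVneq a c; rewrite add0n.
Qed.

Lemma words_block N k a :
  perm_eq [seq x <- words N k.+1 | drop k x == [:: a]]
          (if (0 < N a)%N then [seq rcons u a | u <- words (decv N a) k] else [::]).
Proof.
apply: uniq_perm.
- by rewrite filter_uniq ?words_uniq.
- by case: ifP => // _; rewrite map_inj_uniq ?words_uniq //; apply: rcons_injl.
move=> x; rewrite mem_filter; case: (boolP (size x == k.+1)) => [|sx]; last first.
  rewrite mem_words (negPf sx) andbF; apply/esym; case: ifP => // _.
  apply: contraNF sx => /mapP[u]; rewrite mem_words => /andP[/eqP <- _] ->.
  by rewrite size_rcons.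
case/lastP: x => [//|u b]; rewrite size_rcons eqSS => /eqP su.
rewrite -{1}cats1 -{1}su drop_size_cat // rcons_words eqseq_cons andbT.
have [->|ba] := eqVneq b a; last first.
  rewrite /=; case: ifP => // _; apply/esym/mapP => -[v _ /rcons_inj[_ /eqP]].
  by rewrite (negPf ba).
case: ifP => // _; exact: esym (mem_map (@rcons_injl _ a) _ _).
Qed.

End Boxes.
End Words.

(** * The move-to-front operator *)

Section Operators.
Variables (R : comNzRingType) (K B : nat) (y : 'I_K.+1 -> nat -> R) (lam : R).
Local Notation color := 'I_K.+1.
Local Notation word := (seq color).
Local Notation vec := {ffun color -> 'I_B.+1}.
Implicit Types (N U W M : vec) (k : nat) (a c : color) (u v x z r : word).

Definition occ_weight r p : R := y (nth ord0 r p) (count_mem (nth ord0 r p) (take p r)).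

(* The transpose of the transition matrix: [mtf] acts on functions of words. *)
Definition mtf r r' : R := \sum_(p < size r) occ_weight r p * (step r p == r')%:R.

(** A letter from outside the prefix [u] moves to the front; all of [u] is kept, so the result is
    one letter longer. *)
Definition enter N u z : R :=
  \sum_c (\sum_(count_mem c u <= t < N c) y c t) * (c :: u == z)%:R.

(* The move-to-front walk on words of content [N], seen through a prefix [x]: the
   occurrences of [c] outside [x] are those of index at least [count_mem c x]. *)
Definition mtf_prefix N x z : R :=
  mtf x z + \sum_c (\sum_(count_mem c x <= t < N c) y c t) * (take (size x) (c :: x) == z)%:R.

Definition charS (s : seq word) (F : word -> word -> R) : R :=
  detS s (fun x z => lam *+ (x == z) - F x z).

Lemma mtf_perm r r' : ~~ perm_eq r r' -> mtf r r' = 0.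
Proof.
move=> nrr; rewrite /mtf big1 // => p _.
case: eqP => [e|_]; last by rewrite mulr0.
by rewrite -e perm_sym perm_step in nrr.
Qed.

Lemma mtf_rcons u a z : size z = (size u).+1 ->
  mtf (rcons u a) z = (drop (size u) z == [:: a])%:R * mtf u (take (size u) z)
     + y a (count_mem a u) * (a :: u == z)%:R.
Proof.
move=> sz; rewrite /mtf size_rcons big_ord_recr /=; congr (_ + _); last first.
  by rewrite step_rcons_last /occ_weight nth_rcons ltnn eqxx -cats1 take_size_cat.
rewrite mulr_sumr; apply: eq_bigr => -[p pu] _ /=.
rewrite step_rcons // mulrCA; congr (_ * _).
  by rewrite /occ_weight nth_rcons pu -cats1 takel_cat // ltnW.
rewrite -natrM mulnb andbC -[z in LHS](cat_take_drop (size u)) -cats1 eqseq_cat; last first.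
  by rewrite (perm_size (perm_step pu)) size_takel // sz.
by rewrite [_ == drop _ _]eq_sym.
Qed.

Definition mtf_init k x z : R := (drop k x == drop k z)%:R * mtf (take k x) (take k z).

(** For the prefix of length [k], the last letter of [x] lies outside. The weight of moving it is
    the first term of the outer sum for [take k x], the one that the sum for [x] lacks. *)
Lemma mtf_prefix_split N k x z : x \in words N k.+1 -> size z = k.+1 ->
  mtf_prefix N x z = mtf_init k x z + enter N (take k x) z.
Proof.
case/lastP: x => [|u a] xN sz; first by rewrite mem_words in xN.
have /eqP[su] : size (rcons u a) == k.+1 by move: xN; rewrite mem_words => /andP[].
rewrite size_rcons in su; case: su => su; rewrite -su in xN sz *.
rewrite /mtf_prefix mtf_rcons // -addrA /mtf_init -cats1 take_size_cat // drop_size_cat //.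
rewrite [drop _ z == _]eq_sym; congr (_ + _).
rewrite /enter (bigD1 a) // [RHS](bigD1 a) //= addrA; congr (_ + _).
  rewrite count_cat /= eqxx size_cat /= !addn0 !addn1 /= take_size_cat // -mulrDl.
  congr (_ * _); rewrite [RHS]big_ltn //.
  move: xN; rewrite rcons_words mem_words => /andP[Na] /andP[_ /forallP/(_ a)].
  by rewrite ffunE /= eqxx; lia.
apply: eq_bigr => c /negPf ca.
by rewrite count_cat /= [a == c]eq_sym ca !addn0 size_cat /= addn1 /= take_size_cat.
Qed.

Lemma sum_seq_delta (s : seq word) v (G : word -> R) : uniq s ->
  \sum_(u <- s) (v == u)%:R * G u = G v *+ (v \in s).
Proof.
move=> us; case: (boolP (v \in s)) => vs; last first.
  rewrite big_seq big1 // => u us'; case: eqP => [vu|_]; last by rewrite mul0r.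
  by rewrite vu us' in vs.
rewrite (bigD1_seq v) //= eqxx mul1r big1 ?addr0 // => u.
by rewrite eq_sym => /negPf ->; rewrite mul0r.
Qed.


Lemma take_words N k x : x \in words N k.+1 -> take k x \in words N k.
Proof.
rewrite !mem_words => /andP[/eqP sx /forallP le]; rewrite size_takel ?sx // eqxx.
apply/forallP => c; apply: leq_trans (le c).
by rewrite -{2}(cat_take_drop k x) count_cat leq_addr.
Qed.

(** Entering a letter and then truncating to [k] letters is the outer part of the walk on prefixes
    of length [k]. *)
Lemma mtf_prefix_split_low N k u v : u \in words N k -> 
  mtf_prefix N u v = mtf u v + \sum_(z <- words N k.+1) enter N u z * (take k z == v)%:R.
Proof.
move=> uN; rewrite /mtf_prefix; congr (_ + _); rewrite /enter.
have /eqP su : size u == k by move: uN; rewrite mem_words => /andP[].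
under [RHS]eq_bigr => z _ do rewrite mulr_suml.
rewrite exchange_big; apply: eq_bigr => c _ /=.
(* If no further [c] is available the weight is an empty sum; otherwise [c :: u] is one of the words
   summed over. *)
have [lt|ge] := ltnP (count_mem c u) (N c); last first.
  by rewrite big_geq // mul0r big1 // => z _; rewrite !mul0r.
under [RHS]eq_bigr => z _ do rewrite -mulrA.
by rewrite -mulr_sumr sum_seq_delta ?words_uniq // cons_words lt uN su.
Qed.

Lemma mtf_init_intertwine N k x v : x \in words N k.+1 -> v \in words N k ->
  \sum_(z <- words N k.+1) (lam *+ (x == z) - mtf_init k x z) * (take k z == v)%:R =
  \sum_(u <- words N k) (take k x == u)%:R * (lam *+ (u == v) - mtf u v).
Proof.
move=> xN vN; rewrite sum_seq_delta ?words_uniq //.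
rewrite take_words // mulr1n.
under eq_bigr => z _ do rewrite mulrBl.
rewrite sumrB; congr (_ - _).
  under eq_bigr => z _ do rewrite -[lam *+ _]mulr_natl -mulrA.
  by rewrite sum_seq_delta ?words_uniq // xN mulr1n mulr_natr.
have sv : size v = k by apply/eqP; move: vN; rewrite mem_words => /andP[].
transitivity (\sum_(z <- words N k.+1)
    (v ++ drop k x == z)%:R * mtf (take k x) (take k z)).
  rewrite !big_seq; apply: eq_bigr => z; rewrite mem_words => /andP[/eqP sz _].
  rewrite /mtf_init mulrAC -natrM mulnb andbC; congr (_%:R * _).
  rewrite -[z in RHS](cat_take_drop k) eqseq_cat 1?[v == _]eq_sym //.
  by rewrite sv size_takel // sz.
rewrite sum_seq_delta ?words_uniq // take_size_cat //.
(* If [v] rearranges [take k x], then [v ++ drop k x] is in the list because [x] is; otherwise [mtf]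
   vanishes. *)
case: (boolP (perm_eq (take k x) v)) => [xv|/mtf_perm ->]; last by rewrite mul0rn.
by rewrite -(@perm_words _ _ N _ x) ?xN // -{1}(cat_take_drop k x) perm_cat2r.
Qed.

(* If [I] extends a function of [k] letters to [k + 1] letters and [Q] moves an
   outside letter to the front, the walks on prefixes of lengths [k + 1] and [k]
   are [mtf_init k + I Q] and [mtf + Q I], while [mtf_init k * I = I * mtf]. *)
Lemma charS_sylvester N k :
  charS (words N k.+1) (mtf_prefix N) * charS (words N k) mtf =
  charS (words N k.+1) (mtf_init k) * charS (words N k) (mtf_prefix N).
Proof.
pose I := mxS (words N k.+1) (words N k) (fun x u => (take k x == u)%:R : R).
pose Q := mxS (words N k) (words N k.+1) (enter N).
pose L F : word -> word -> R := fun x z => lam *+ (x == z) - F x z.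
have := @sylvester _ _ _ (mxS (words N k.+1) (words N k.+1) (L (mtf_init k)))
  (mxS (words N k) (words N k) (L mtf)) I Q.
rewrite !mul_mxS !opp_mxS !add_mxS => H.
have {}H := H (eq_mxS (@mtf_init_intertwine N k)).
rewrite /charS (_ : detS (words N k.+1) _ = \det (mxS (words N k.+1) (words N k.+1)
      (fun x z => L (mtf_init k) x z -
         \sum_(u <- words N k) (take k x == u)%:R * enter N u z))) ?H.
  congr (_ * _); apply: eq_detS => u v uN vN.
  by rewrite (mtf_prefix_split_low _ uN) opprD addrA.
apply: eq_detS => x z xN zN; rewrite sum_seq_delta ?words_uniq //.
have /eqP sz : size z == k.+1 by move: zN; rewrite mem_words => /andP[].
rewrite (mtf_prefix_split xN sz) opprD addrA take_words //.
Qed.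

(** The last letter is frozen, so the matrix splits into blocks by that letter; freezing an [a]
    leaves words bounded by [decv N a]. *)
Lemma charS_init N k :
  charS (words N k.+1) (mtf_init k) =
  \prod_(a | (0 < N a)%N) charS (words (decv N a) k) mtf.
Proof.
rewrite /charS (@detS_blocks _ _ _ (drop k) [seq [:: a] | a : color]).
- rewrite big_map big_enum [RHS]big_mkcond /=; apply: eq_bigr => a _.
  rewrite (detS_perm _ (words_block N k a)); case: ifP => Na; last by rewrite detS_nil.
  rewrite detS_map; apply: eq_detS => u v.
  rewrite !mem_words => /andP[/eqP su _] /andP[/eqP sv _].
  rewrite eqseq_rcons eqxx andbT /mtf_init -!cats1.
  by rewrite (drop_size_cat _ su) (drop_size_cat _ sv) (take_size_cat _ su)
             (take_size_cat _ sv) eqxx mul1r.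
- by rewrite map_inj_uniq ?enum_uniq // => a b [].
- move=> x; rewrite mem_words => /andP[/eqP sx _].
  have : size (drop k x) = 1%N by rewrite size_drop sx subSnn.
  by case: (drop k x) => [|a []] // _; rewrite map_f // mem_enum.
- move=> x z _ _ xz; rewrite /mtf_init (negPf xz) mul0r subr0.
  by have [E|//] := eqVneq x z; rewrite E eqxx in xz.
Qed.

(** Grouped by length, which suits the telescoping; [Psi_chi] regroups it by content. *)
Definition Psi N := \prod_(k < (weight N).+1) charS (words N k) mtf.

Definition sumv N : R := \sum_c \sum_(0 <= t < N c) y c t.

Lemma charS_prefix_full N :
  charS (words N (weight N)) (mtf_prefix N) = charS (words N (weight N)) mtf.
Proof.
apply: eq_detS => u v uN vN; congr (_ - _).
rewrite /mtf_prefix big1 ?addr0 // => c _.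
by rewrite (words_full uN) // big_geq // mul0r.
Qed.

(** On the empty prefix every move is a loop, and the loops have total weight [sumv N]. *)
Lemma charS_prefix0 N : charS (words N 0) (mtf_prefix N) = lam - sumv N.
Proof.
have w0 : perm_eq (words N 0) [:: [::]].
  apply: uniq_perm; rewrite ?words_uniq // => u; rewrite mem_words inE size_eq0.
  by case: eqP => //= ->; apply/forallP.
rewrite /charS (detS_perm _ w0) detS_seq1 eqxx mulr1n /mtf_prefix /mtf big_ord0 add0r.
by congr (_ - _); apply: eq_bigr => c _ /=; rewrite mulr1.
Qed.

Lemma Psi_rec N :
  Psi N = (lam - sumv N) * \prod_(a | (0 < N a)%N) Psi (decv N a).
Proof.
(* Stated as an equality of products, so that no determinant is divided by. At [k = weight N] the
   left side is [Psi N]. *)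
have telescope k : charS (words N k) (mtf_prefix N) * \prod_(j < k) charS (words N j) mtf =
    (lam - sumv N) * \prod_(j < k) charS (words N j.+1) (mtf_init j).
  elim: k => [|k IH]; first by rewrite !big_ord0 charS_prefix0.
  by rewrite !big_ord_recr /= mulrCA charS_sylvester [RHS]mulrA -IH mulrCA [RHS]mulrC [X in _ = _ * X]mulrC.
rewrite [LHS]big_ord_recr /= [LHS]mulrC -charS_prefix_full telescope.
congr (_ * _); rewrite (eq_bigr _ (fun (j : 'I_(weight N)) _ => charS_init N j)).
by rewrite exchange_big; apply: eq_bigr => a Na; rewrite /Psi (weight_dec Na).
Qed.

End Operators.

(** * Fixed points of words *)

Section FixedPoints.
Local Open Scope nat_scope.
Variable (T : eqType).
Implicit Types (c t x : T) (w v : seq T).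

(* In a word with [M] letters of colours smaller than [c], the [t]-th [c] (counting
   from 0) is labelled [M + t], so it is a fixed point of the linear extension iff
   exactly [M] letters other than [c] precede it. *)
Fixpoint hasfix c (M : nat) w : bool :=
  if w is x :: w' then
    if x == c then (M == 0) || hasfix c M w' else (0 < M) && hasfix c M.-1 w'
  else false.

Lemma hasfixP c M w x0 :
  reflect (exists2 j, j < size w & (nth x0 w j == c) && (count (predC1 c) (take j w) == M))
          (hasfix c M w).
Proof.
elim: w M => [|x w IH] M /=; first by constructor => -[].
case: eqP => [->|/eqP xc].
  apply: (iffP orP) => [[/eqP ->|/IH[j jw H]]|[[|j] jw /= H]].
  - by exists 0; rewrite //= eqxx.
  - by exists j.+1; rewrite //= eqxx.
  - by left; rewrite eq_sym; case/andP: H.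
  - by right; apply/IH; exists j => //; move: H; rewrite eqxx.
apply: (iffP andP) => [[M0 /IH[j jw /andP[jc /eqP H]]]|[[|j] jw /= /andP[jc /eqP H]]].
- by exists j.+1; rewrite //= jc xc H add1n prednK /=.
- by rewrite jc in xc.
- rewrite xc in H; rewrite -H /=; split => //.
  by apply/IH; exists j; rewrite ?jc /=.
Qed.

(** A fixed point of colour [c] stands at index [M] plus the number of earlier [c]s, hence before
    [L]. *)
Lemma hasfix_take c M w L : M + count_mem c w <= L -> hasfix c M (take L w) = hasfix c M w.
Proof.
elim: w M L => [|x w IH] M [|L] //=.
  rewrite leqn0 addn_eq0 => /andP[/eqP ->]; rewrite addn_eq0 eqb0 => /andP[/negPf xc].
  rewrite xc eqn0Ngt -has_count => /hasPn H; apply/esym => /=.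
  by case: (w) H.
case: eqP => [_|_] H; first by rewrite IH //; lia.
by case: M H => [|M] H //=; rewrite IH //; lia.
Qed.

(* The fixed points of colour [t] form the run of [t]s that follows the [M]-th
   letter other than [t]; [ins] and [del] change the length of this run by one. *)
Fixpoint ins t (M : nat) w : seq T :=
  if M is M'.+1 then
    if w is x :: w' then x :: ins t (if x == t then M else M') w' else [:: t]
  else t :: w.

Fixpoint del t (M : nat) v : seq T :=
  if v is x :: v' then
    if M is M'.+1 then x :: del t (if x == t then M else M') v' else v'
  else [::].

Lemma insK t M w : M <= count (predC1 t) w -> del t M (ins t M w) = w.
Proof.
elim: w M => [|x w IH] [|M] //= H; congr (_ :: _); apply: IH.
by case: eqP H => _ /=; lia.
Qed.

Lemma delK t M v : hasfix t M v -> ins t M (del t M v) = v.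
Proof.
elim: v M => [|x v IH] [|M] //=; first by case: eqP => [->|//] _; case: v {IH}.
by have [_|_] := eqVneq x t => H; rewrite IH.
Qed.

Lemma hasfix_ins t M w : M <= count (predC1 t) w -> hasfix t M (ins t M w).
Proof.
elim: w M => [|x w IH] [|M] //=; rewrite ?eqxx //.
by case: eqP => _ /= H; apply: IH; lia.
Qed.

Lemma perm_ins t M w : perm_eq (ins t M w) (t :: w).
Proof.
elim: w M => [|x w IH] [|M] //=.
rewrite -[t :: _]/([:: t] ++ [:: x] ++ w) perm_sym perm_catCA /= perm_cons perm_sym.
exact: IH.
Qed.

Lemma take_ins t L M w : L <= M -> M <= count (predC1 t) w ->
  take L (ins t M w) = take L w.
Proof.
elim: w L M => [|x w IH] [|L] [|M] //= LM H; congr (_ :: _).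
by case: eqP H => _ /= H; apply: IH; lia.
Qed.

End FixedPoints.

(** * Counting words by the derangements they reduce to *)

Section Derangements.
Local Open Scope nat_scope.
Variables K B : nat.
Local Notation color := 'I_K.+1.
Local Notation word := (seq color).
Local Notation vec := {ffun color -> 'I_B.+1}.
Implicit Types (N U W M : vec) (k : nat) (a c t : color) (u v x w : word).

(** The number of labels preceding chain [c], that is, its smallest 0-based label. *)
Definition below N c : nat := \sum_(b : color | b < c) N b.

(** The parameter [s] interpolates between all words ([s = 0]) and derangements ([s = K.+1]). *)
Definition avoid (s : nat) N w : bool :=
  [forall c : color, (c < s) ==> ~~ hasfix c (below N c) w].

Definition avoiders (s : nat) N : seq word :=
  [seq w <- words N (weight N) | avoid s N w].

Lemma mem_avoiders s N w :
  (w \in avoiders s N) = avoid s N w && (w \in words N (weight N)).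
Proof. by rewrite mem_filter. Qed.

Lemma below_lt N c t : c < t -> below N c + N c <= below N t.
Proof.
move=> ct; rewrite /below [leqRHS](bigD1 c) //= addnC leq_add2l.
rewrite big_mkcond [leqRHS]big_mkcond; apply: leq_sum => b _.
by case: ifP => // bc; rewrite (ltn_trans bc ct) /= -(inj_eq val_inj) neq_ltn bc.
Qed.

Lemma below_dec N c t : c <= t -> below (decv N t) c = below N c.
Proof.
move=> ct; apply: eq_bigr => b bc; rewrite ffunE /=.
by rewrite -(inj_eq val_inj) ltn_eqF ?subn0 // (leq_trans bc ct).
Qed.

Lemma below_count N t w : w \in words (decv N t) (weight (decv N t)) ->
  below N t <= count (predC1 t) w.
Proof.
move=> wN; have H := words_full wN erefl.
have -> : count (predC1 t) w = \sum_(c | c != t) N c.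
  apply/eqP; rewrite -(eqn_add2l (count_mem t w)) count_predC size_count (bigD1 t) //=.
  rewrite eqn_add2l; apply/eqP; apply: eq_bigr => c /negPf ct.
  by rewrite H ffunE /= ct subn0.
rewrite /below big_mkcond [leqRHS]big_mkcond; apply: leq_sum => b _ /=.
by case: ifP => // bt; rewrite -(inj_eq val_inj) neq_ltn bt.
Qed.

Lemma ins_words N t w : 0 < N t -> 
  (ins t (below N t) w \in words N (weight N)) = (w \in words (decv N t) (weight (decv N t))).
Proof.
move=> Nt; rewrite (perm_words _ _ (perm_ins _ _ _)) -(weight_dec Nt).
have pt : perm_eq (t :: w) (rcons w t) by rewrite perm_sym perm_rcons.
by rewrite (perm_words _ _ pt) rcons_words Nt.
Qed.

(* A fixed point of colour [c < t] lies in block [c], hence before position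
   [below N t], where the insertion of [t] has not changed the word. *)
Lemma avoid_ins N t w : 0 < N t -> w \in words (decv N t) (weight (decv N t)) ->
  avoid t N (ins t (below N t) w) = avoid t (decv N t) w.
Proof.
move=> Nt wN; apply: eq_forallb => c; case: ltnP => //= ct.
rewrite below_dec; last exact: ltnW.
have H : ins t (below N t) w \in words N (weight N) by rewrite ins_words.
have bl := below_lt N ct.
rewrite -(@hasfix_take _ _ _ _ (below N t)) ?(words_full H) //.
rewrite take_ins ?below_count // hasfix_take // (words_full wN) // ffunE /=.
by apply: leq_trans bl; rewrite leq_add2l leq_subr.
Qed.

Lemma hasfix_words N t w : w \in words N (weight N) -> hasfix t (below N t) w -> 0 < N t.
Proof.
move=> wN; rewrite -(words_full wN erefl) -has_count; elim: (w) (below N t) => //= x v IH M.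
by case: eqP => //= _ /andP[_ /IH].
Qed.

Lemma avoidS t N w : avoid t.+1 N w = avoid t N w && ~~ hasfix t (below N t) w.
Proof.
apply/forallP/andP => [H|[/forallP H1 H2] c].
  split; last by have := H t; rewrite ltnSn.
  by apply/forallP => c; apply/implyP => ct; have := H c; rewrite ltnS ltnW.
rewrite ltnS leq_eqVlt; have [/val_inj ->//|/= _] := eqVneq (val c) (val t).
exact: H1.
Qed.

(** Among these words, those with a fixed point of colour [t] correspond to the avoiders of content
    [decv N t]: [del] erases one fixed point and [ins] restores it. *)
Lemma size_avoiders_rec t N :
  size (avoiders t N) =
  size (avoiders t.+1 N) + (if 0 < N t then size (avoiders t (decv N t)) else 0).
Proof.
rewrite -[in LHS](perm_size (permEl (perm_filterC (fun w => ~~ hasfix t (below N t) w) _))).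
have F (p : pred word) : [seq w <- avoiders t N | p w] =
    [seq w <- words N (weight N) | p w && avoid t N w] by rewrite -filter_predI.
rewrite size_cat !F; congr (_ + _).
  congr size; apply: eq_filter => w /=; by rewrite avoidS andbC.
transitivity (size (if 0 < N t then
    [seq ins t (below N t) w | w <- avoiders t (decv N t)] else [::])); last first.
  by case: ifP; rewrite ?size_map.
apply: perm_size; apply: uniq_perm.
- exact: filter_uniq (words_uniq _ _).
- case: ifP => // _; rewrite map_inj_in_uniq; first exact: filter_uniq (words_uniq _ _).
  move=> u v.
  rewrite !mem_avoiders => /andP[_ uN] /andP[_ vN] e.
  by rewrite -(insK (below_count uN)) e insK ?below_count.
move=> w; rewrite mem_filter /= negbK; case: ifP => Nt; last first.
  apply/negP => /andP[/andP[H _] wN].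
  by rewrite (hasfix_words wN H) in Nt.
apply/idP/mapP => [/andP[/andP[H av] wN]|[u]].
  have E := delK H.
  have dN : del t (below N t) w \in words (decv N t) (weight (decv N t)).
    by rewrite -ins_words // E.
  by exists (del t (below N t) w) => //; rewrite mem_avoiders dN -avoid_ins // E av.
rewrite mem_avoiders => /andP[av uN] ->.
by rewrite hasfix_ins ?below_count // avoid_ins // av ins_words.
Qed.

Definition der N : nat := size (avoiders K.+1 N).

Lemma lev_dec U N a : (0 < N a) && lev U (decv N a) = lev U N && (U a < N a).
Proof.
apply/andP/andP => [[Na /forallP H]|[/forallP H Ua]].
  split; last by have := H a; rewrite ffunE /= eqxx; lia.
  by apply/forallP => c; have := H c; rewrite ffunE /=; lia.
split; first by lia.
apply/forallP => c; have := H c; rewrite ffunE /=.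
by have [->|] := eqVneq c a; lia.
Qed.

(** Fixed points are erased colour by colour from [s] on. The remaining content [U] therefore agrees
    with [N] on the colours below [s]. *)
Lemma size_avoiders (s : nat) N : s <= K.+1 ->
  size (avoiders s N) =
  \sum_(U | lev U N && [forall c : color, (c < s) ==> (U c == N c)]) der U.
Proof.
(* Each use of the recursion either raises [s] or lowers the weight. *)
move=> sK; have [m] := ubnP (K.+1 - s + weight N).
elim: m => // m IH in s N sK *; rewrite ltnS => le.
have [sK'|sK'] := ltnP s K.+1; last first.
  have -> : s = K.+1 by lia.
  rewrite (big_pred1 N) // => U /=; apply/andP/eqP => [[_ /forallP H]|->].
    by apply/ffunP => c; apply/eqP; have := H c; rewrite ltn_ord.
  by split; apply/forallP => c; rewrite ?eqxx ?implybT.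
pose t := Ordinal sK'; rewrite -[s]/(nat_of_ord t) size_avoiders_rec.
rewrite (bigID (fun U => U t == N t)) /=; congr (_ + _).
  rewrite IH //; last by rewrite /=; lia.
  apply: eq_bigl => U; rewrite -andbA; congr (_ && _).
  apply/forallP/andP => [H|[/forallP H1 H2] c].
    split; last by have := H t; rewrite ltnSn.
    by apply/forallP => c; apply/implyP => ct; have := H c; rewrite ltnS ltnW.
  rewrite ltnS leq_eqVlt; have [/val_inj ->//|/= _] := eqVneq (val c) (val t).
  exact: H1.
case: ifP => Nt; last first.
  rewrite big_pred0 // => U; apply/negP => /andP[/andP[/forallP/(_ t) H _]].
  by rewrite -(inj_eq val_inj) /=; lia.
rewrite IH //; last by have := weight_dec Nt; rewrite /=; lia.
apply: eq_bigl => U.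
have -> : lev U (decv N t) = lev U N && (U t != N t).
  have := lev_dec U N t; rewrite Nt /= => ->.
  case lUN: (lev U N) => //=; move/forallP/(_ t): lUN.
  by rewrite leq_eqVlt -(inj_eq val_inj) /= => /orP[/eqP ->|lt]; rewrite ?ltnn ?eqxx ?lt ?ltn_eqF.
rewrite -!andbA; congr (_ && _); rewrite andbC; congr (_ && _).
apply: eq_forallb => c; case: ltnP => //= ct.
by rewrite ffunE -!(inj_eq val_inj) /= (ltn_eqF ct) subn0.
Qed.

Definition nwords N := size (words N (weight N)).

Lemma nwordsE N : nwords N = \sum_(U | lev U N) der U.
Proof.
rewrite /nwords; have := @size_avoiders 0 N isT; rewrite /avoiders.
have -> : [seq w <- words N (weight N) | avoid 0 N w] = words N (weight N).
  by apply/all_filterP/allP => w _; apply/forallP.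
move=> ->; apply: eq_bigl => U; rewrite andbC.
by have -> : [forall c : color, (c < 0) ==> (U c == N c)] by apply/forallP.
Qed.

End Derangements.

(** * The characteristic polynomial in terms of contents *)

Section BoxCounting.
Local Open Scope nat_scope.
Variables K B : nat.
Local Notation color := 'I_K.+1.
Local Notation vec := {ffun color -> 'I_B.+1}.
Implicit Types (N U W M : vec) (k : nat) (a c : color).

Lemma levP U N : reflect (forall c, U c <= N c) (lev U N).
Proof. exact: forallP. Qed.

Lemma lev_refl N : lev N N.
Proof. by apply/levP. Qed.

Lemma lev_trans W U N : lev U W -> lev W N -> lev U N.
Proof. by move=> /levP UW /levP WN; apply/levP => c; apply: leq_trans (WN c). Qed.

Lemma lev_neq_weight U N : lev U N -> U != N -> weight U < weight N.
Proof.
move=> /levP UN; apply: contraNltn => H; apply/eqP/ffunP => c; apply/val_inj => /=.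
apply/eqP; rewrite eqn_leq UN leqNgt; apply/negP => lt.
move: H; apply/negP; rewrite -ltnNge /weight (bigD1 c) //= [ltnRHS](bigD1 c) //=.
by rewrite -addSn leq_add // leq_sum.
Qed.

Lemma subv_dec N U a : decv (subv N U) a = subv (decv N a) U.
Proof. by apply/ffunP => c; rewrite !ffunE; apply/val_inj => /=; rewrite subnAC. Qed.

(** Words are sorted by their last letter; the extra term counts the empty word. *)
Lemma nwords_rec N :
  nwords N = (weight N == 0) + \sum_(a | 0 < N a) nwords (decv N a).
Proof.
rewrite /nwords; case wN: (weight N) => [|k].
  rewrite big_pred0 => [|a].
    rewrite (@perm_size _ _ [:: [::]]) //; apply: uniq_perm; rewrite ?words_uniq // => u.
    rewrite mem_words inE size_eq0; case: eqP => //= ->.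
    by apply/forallP.
  by apply/negP => /weight_dec; rewrite wN.
rewrite add0n -[LHS]sum1_size.
transitivity (\sum_(x <- words N k.+1) \sum_a (drop k x == [:: a])).
  rewrite !big_seq; apply: eq_bigr => x; rewrite mem_words => /andP[/eqP sx _].
  have : size (drop k x) = 1 by rewrite size_drop sx subSnn.
  case: (drop k x) => [|b []] // _; rewrite (bigD1 b) //= eqxx big1 // => c.
  by rewrite eqseq_cons andbT eq_sym => /negPf ->.
rewrite exchange_big [RHS]big_mkcond; apply: eq_bigr => a _ /=.
rewrite -big_mkcond /= sum1_count -size_filter (perm_size (words_block N k a)).
case: ifP => // Na; rewrite size_map; congr (size (words _ _)).
by have := weight_dec Na; rewrite wN => -[].
Qed.

End BoxCounting.

Section Spectrum.
Variables (R : idomainType) (K B : nat) (y : 'I_K.+1 -> nat -> R) (lam : R).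
Local Notation color := 'I_K.+1.
Local Notation vec := {ffun color -> 'I_B.+1}.
Implicit Types (N U W M : vec) (k : nat) (a c : color).

Local Notation chi N := (charS lam (words N (weight N)) (mtf y)).
Local Notation f U := (lam - sumv y U).

(** By [Psi_rec], the exponent of [f U] obeys the recursion [nwords_rec] for [subv N U]; the leading
    factor [f N] accounts for the empty word, which occurs at [U = N]. *)
Lemma Psi_prod N : Psi y lam N = \prod_(U | lev U N) f U ^+ nwords (subv N U).
Proof.
have [m] := ubnP (weight N); elim: m => // m IH in N *; rewrite ltnS => Nm.
rewrite Psi_rec.
transitivity (f N * \prod_(a | (0 < N a)%N) \prod_(U | lev U (decv N a))
                 f U ^+ nwords (subv (decv N a) U)).
  by congr (_ * _); apply: eq_bigr => a Na; rewrite IH // -ltnS weight_dec.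
transitivity (\prod_(U | lev U N) (f U ^+ (U == N) *
    \prod_(a | (0 < N a)%N && lev U (decv N a)) f U ^+ nwords (subv (decv N a) U))).
  rewrite big_split /=; congr (_ * _).
    rewrite (bigD1 N) ?lev_refl //= eqxx expr1 big1 ?mulr1 // => U /andP[_ /negPf ->].
    by rewrite expr0.
  rewrite (exchange_big_dep (fun U => lev U N)) /=; last first.
    by move=> a U Na H; move: (lev_dec U N a); rewrite Na H => /esym/andP[].
  by apply: eq_bigr => U _; apply: eq_bigl => a.
apply: eq_bigr => U UN; rewrite nwords_rec exprD expr_sum; congr (_ ^+ _ * _).
  congr nat_of_bool; apply/eqP/eqP => [->|H].
    by rewrite /weight big1 // => c _; rewrite ffunE /= subnn.
  apply/ffunP => c; apply/val_inj => /=; apply/eqP; rewrite eqn_leq (levP _ _ UN) /=.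
  move: H => /eqP; rewrite sum_nat_eq0 => /forallP/(_ c).
  by rewrite ffunE /= subn_eq0.
apply: eq_big => a; first by rewrite lev_dec UN ffunE /= subn_gt0.
by rewrite subv_dec.
Qed.

(** Moves preserve the content, so the matrix is block diagonal with one block per content. *)
Lemma charS_words_prod N k :
  charS lam (words N k) (mtf y) = \prod_(U | lev U N && (weight U == k)) chi U.
Proof.
pose content (u : seq color) : vec := [ffun c => inord (count_mem c u)].
have contE u c : u \in words N k -> content u c = count_mem c u :> nat.
  rewrite mem_words => /andP[_ /forallP/(_ c) le]; rewrite ffunE inordK //.
  exact: leq_ltn_trans le (ltn_ord _).
rewrite /charS (@detS_blocks _ _ _ content (enum {: vec})) ?enum_uniq //; first last.
- move=> u v uN vN uv; have uv' : ~~ perm_eq u v.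
    apply: contra uv => /seq.permP uv; apply/eqP/ffunP => c; apply/val_inj => /=.
    by rewrite !contE.
  rewrite mtf_perm // subr0; have [E|//] := eqVneq u v.
  by rewrite E eqxx in uv.
- by move=> u _; rewrite mem_enum.
rewrite big_enum [RHS]big_mkcond; apply: eq_bigr => U _ /=.
case: ifP => [/andP[UN /eqP kU]|H].
  apply: detS_perm; apply: uniq_perm; rewrite ?words_uniq //.
    exact: filter_uniq (words_uniq _ _).
  move=> u; rewrite mem_filter; apply/andP/idP => [[/eqP <- uN]|uU].
    rewrite words_weight // => c; rewrite contE //.
  have uN : u \in words N k.
    move: uU; rewrite !mem_words kU => /andP[-> /forallP le].
    by apply/forallP => c; apply: leq_trans (le c) (levP _ _ UN c).
  split => //; apply/eqP/ffunP => c; apply/val_inj; rewrite /= contE //.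
  exact: (words_full uU).
set s := filter _ _; suff -> : s = [::] by rewrite detS_nil.
case E: s => [//|u s']; have : u \in s by rewrite E mem_head.
rewrite mem_filter => /andP[/eqP uU uN]; move: H; rewrite -uU => /negP[]; apply/andP; split.
  by apply/levP => c; rewrite contE //; move: uN; rewrite mem_words => /andP[_ /forallP].
move: (uN); rewrite mem_words => /andP[/eqP <- _]; rewrite size_count.
by apply/eqP; apply: eq_bigr => c _; rewrite contE.
Qed.

Lemma Psi_chi N : Psi y lam N = \prod_(U | lev U N) chi U.
Proof.
rewrite /Psi (eq_bigr _ (fun (k : 'I_(weight N).+1) _ => charS_words_prod N k)).
have le U : lev U N -> (weight U < (weight N).+1)%N.
  by move=> /levP UN; rewrite ltnS leq_sum.
rewrite (partition_big (fun U => inord (weight U) : 'I_(weight N).+1) xpredT) //=.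
apply: eq_bigr => k _. apply: eq_bigl => U; case UN: (lev U N) => //=.
by rewrite -(inj_eq val_inj) /= inordK // le.
Qed.

Hypothesis f_neq0 : forall U, f U != 0.

(* Both sides have the same product over the contents [W <= N], so the formula at
   [N] follows by cancelling the factors for [W < N]. *)
Lemma chi_prod N : chi N = \prod_(U | lev U N) f U ^+ der (subv N U).
Proof.
have [m] := ubnP (weight N); elim: m => // m IH in N *; rewrite ltnS => Nm.
have E : \prod_(W | lev W N) chi W =
         \prod_(W | lev W N) \prod_(U | lev U W) f U ^+ der (subv W U).
  rewrite -Psi_chi Psi_prod (exchange_big_dep (fun U => lev U N)) /=; last first.
    by move=> W U WN UW; apply: lev_trans WN.
  apply: eq_bigr => U UN; rewrite prodrXr; congr (_ ^+ _).
  (* The inverse of subtracting [U] is adding it; for [V <= N - U] the sum is at most [N], so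
     [inord] keeps its value. *)
  rewrite nwordsE (reindex_onto (fun W => subv W U)
     (fun V => [ffun c => inord (V c + U c)] : vec)) /=; last first.
    move=> V /levP VN; apply/ffunP => c; rewrite !ffunE; apply/val_inj => /=.
    rewrite inordK ?addnK //; have := VN c; have := levP _ _ UN c.
    by rewrite ffunE /=; have := ltn_ord (N c); lia.
  apply: eq_bigl => W; apply/andP/andP => [[/levP H /eqP/ffunP H']|[/levP WN /levP UW]].
    have UW c : (U c <= W c)%N.
      have := congr1 val (H' c); rewrite !ffunE /=.
      rewrite [in X in _ -> X]leqNgt => e; apply/negP => lt; move: e.
      have -> : (W c - U c + U c = U c)%N by lia.
      by rewrite inord_val => e; rewrite e ltnn in lt.
    split; apply/levP => c //; have := H c; rewrite !ffunE /=.
    by have := UW c; have := levP _ _ UN c; lia.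
  split; first by apply/levP => c; rewrite !ffunE /= leq_sub2r.
  apply/eqP/ffunP => c; apply/val_inj; rewrite !ffunE /= subnK //.
  by rewrite inord_val.
move: E; rewrite (bigD1 N) ?lev_refl //= [RHS](bigD1 N) ?lev_refl //=.
rewrite (eq_bigr (fun W => \prod_(U | lev U W) f U ^+ der (subv W U))); last first.
  by move=> W /andP[WN neq]; apply: IH; apply: leq_trans (lev_neq_weight WN neq) Nm.
apply: mulIf; apply/prodf_neq0 => W _; apply/prodf_neq0 => U _.
exact: expf_neq0.
Qed.

End Spectrum.

(** * Linear extensions of a union of chains as words *)

Section LinearExtensions.
Local Open Scope nat_scope.
Variables (m K B : nat) (r : rel 'I_m) (col : 'I_m -> 'I_K.+1).
Variable N : {ffun 'I_K.+1 -> 'I_B.+1}.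
Hypothesis col_mono : forall a b : 'I_m, a <= b -> col a <= col b.
Hypothesis rE : forall a b, r a b = (col a == col b) && (a < b).
Hypothesis NE : forall c, #|[pred a | col a == c]| = N c.
Implicit Types (a b i j : 'I_m) (p q : 'S_m) (c : 'I_K.+1) (u w : seq 'I_K.+1).

Lemma card_ord_lt x : x <= m -> #|[pred b : 'I_m | b < x]| = x.
Proof.
by move=> xm; rewrite -sum1_card -(big_ord_widen m (fun=> 1) xm) sum_nat_const card_ord muln1.
Qed.

Lemma card_colour_lt c : #|[pred a | col a < c]| = below N c.
Proof.
rewrite -sum1_card (partition_big col (fun d => d < c)) //; apply: eq_bigr => d dc.
rewrite -NE -sum1_card; apply: eq_bigl => a /=.
by rewrite !inE andbC; have [->|//] := eqVneq (col a) d; rewrite dc.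
Qed.

(** As colours increase with labels, the labels below [a] are those of smaller colours and the
    earlier ones in its own chain. *)
Lemma rankE a : a = below N (col a) + #|[pred b : 'I_m | (b < a) && (col b == col a)]| :> nat.
Proof.
rewrite -[LHS](card_ord_lt (ltnW (ltn_ord a))) -card_colour_lt.
rewrite -(cardID [pred b | col b == col a]) addnC; congr (_ + _); apply: eq_card => b.
  rewrite !inE; apply/andP/idP => [[ne lt]|lt].
    by rewrite ltn_neqAle (inj_eq val_inj) ne col_mono // ltnW.
  rewrite -(inj_eq val_inj) neq_ltn lt; split=> //.
  by rewrite ltnNge; apply: contraL lt => /col_mono; rewrite -leqNgt.
Qed.

Lemma rank_bound a : a < below N (col a) + N (col a).
Proof.
rewrite [ltnLHS]rankE ltn_add2l -NE; apply: proper_card; apply/properP; split.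
  by apply/subsetP => b; rewrite !inE => /andP[].
by exists a; rewrite !inE ?eqxx // ltnn.
Qed.

Lemma col_interval c a : below N c <= a < below N c + N c -> col a = c.
Proof.
move=> /andP[ge lt]; have [ca|ca|/val_inj//] := ltngtP (col a) c.
  have := leq_trans (rank_bound a) (leq_trans (below_lt N ca) ge).
  by rewrite ltnn.
have := leq_trans lt (below_lt N ca); rewrite ltnNge.
by rewrite [X in _ <= X](rankE a) leq_addr.
Qed.

Lemma weight_card : weight N = m.
Proof.
rewrite -[RHS]card_ord -sum1_card (partition_big col predT) //; apply: eq_bigr => c _.
by rewrite -NE -sum1_card.
Qed.

Lemma below_le c : below N c + N c <= m.
Proof.
rewrite -weight_card /weight (bigID (fun b : 'I_K.+1 => b < c)) /= leq_add2l.
by rewrite (bigD1 c) ?ltnn //= leq_addr.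
Qed.

Definition pword p : seq 'I_K.+1 := [seq col (p j) | j <- enum 'I_m].

Lemma size_pword p : size (pword p) = m.
Proof. by rewrite size_map size_enum_ord. Qed.

Lemma nth_pword p j : nth ord0 (pword p) j = col (p j).
Proof. by rewrite (nth_map j) ?size_enum_ord // nth_ord_enum. Qed.

Lemma count_take_pword p j (P : pred 'I_K.+1) :
  count P (take j (pword p)) = #|[pred i : 'I_m | (i < j) && P (col (p i))]|.
Proof.
rewrite /pword -map_take count_map -sum1_card -sum1_count.
have -> : take j (enum 'I_m) = [seq i : 'I_m <- enum 'I_m | i < j].
  apply: (inj_map val_inj); rewrite map_take val_enum_ord.
  have -> : map val [seq i : 'I_m <- enum 'I_m | i < j] = [seq i <- iota 0 m | i < j].
    by rewrite -val_enum_ord filter_map.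
  rewrite take_iota.
  move: (nat_of_ord j) (ltnW (ltn_ord j)) => k jm; rewrite (minn_idPl jm) -[in RHS](subnKC jm) iotaD filter_cat.
  rewrite (all_filterP _); last by apply/allP => x; rewrite mem_iota.
  rewrite (@eq_in_filter _ _ pred0) ?filter_pred0 ?cats0 // => x.
  by rewrite mem_iota => /andP[jx _]; rewrite ltnNge jx.
by rewrite big_filter_cond big_enum_cond /=; apply: eq_bigl => i; rewrite !inE.
Qed.

Lemma count_pword p c : count_mem c (pword p) = N c.
Proof.
rewrite -NE /pword count_map -sum1_count big_enum_cond /= -sum1_card.
by rewrite [RHS](reindex_inj (@perm_inj _ p)) /=; apply: eq_bigl => i; rewrite !inE.
Qed.

Lemma pword_words p : pword p \in words N (weight N).
Proof. by apply: words_weight => // c; apply: count_pword. Qed.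

Lemma linextP p :
  reflect (forall i j, i < j -> col (p i) = col (p j) -> p i < p j) (linext_rel r p).
Proof.
apply: (iffP forallP) => [H i j ij e|H a].
  rewrite ltnNge; apply/negP; rewrite leq_eqVlt (inj_eq val_inj) (inj_eq perm_inj).
  rewrite -(inj_eq val_inj) eq_sym ltn_eqF //= => lt.
  have /forallP/(_ (p i))/implyP := H (p j); rewrite rE e eqxx lt !permK => /(_ isT).
  by rewrite ltnNge ltnW.
apply/forallP => b; apply/implyP; rewrite rE => /andP[/eqP ab lt].
rewrite ltnNge; apply/negP; rewrite leq_eqVlt => /orP[/eqP/val_inj/perm_inj e|].
  by rewrite e ltnn in lt.
by move/H; rewrite !permKV => /(_ (esym ab)); rewrite ltnNge ltnW.
Qed.

(** A linear extension lists each chain in increasing order, so the equal letters before position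
    [j] mark exactly the elements below [p j] in its chain. Hence the word determines [p]. *)
Lemma linext_rank p j : linext_rel r p ->
  p j = below N (col (p j)) + count_mem (col (p j)) (take j (pword p)) :> nat.
Proof.
move=> /linextP H; rewrite [LHS]rankE count_take_pword; congr (_ + _).
rewrite -[RHS](card_image (@perm_inj _ p)); apply: eq_card => b; rewrite !inE /=.
apply/andP/imageP => [[lt /eqP e]|[i]].
  exists (p^-1 b)%g; rewrite ?permKV // !inE permKV e eqxx andbT ltnNge leq_eqVlt.
  apply/negP => /orP[/eqP/val_inj E|/H]; first by rewrite E permKV ltnn in lt.
  by rewrite permKV e => /(_ erefl); rewrite ltnNge ltnW.
by rewrite !inE => /andP[ij /eqP e] ->; rewrite e H.
Qed.

Lemma pword_inj : {in [pred p | linext_rel r p] &, injective pword}.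
Proof.
move=> p q; rewrite !inE => Lp Lq e; apply/permP => j; apply/val_inj.
by rewrite /= linext_rank // [RHS]linext_rank // -!nth_pword e.
Qed.

(** The preimage is the standardisation of [u]: occurrence number [t] of [c], from 0, receives the
    label [below N c + t]. *)
Lemma pword_surj u : u \in words N (weight N) -> exists2 p, linext_rel r p & pword p = u.
Proof.
move=> uN; have cu := words_full uN erefl.
have su : size u = m by move: uN; rewrite mem_words weight_card => /andP[/eqP].
pose c j := nth ord0 u j.
have bound j : below N (c j) <= below N (c j) + count_mem (c j) (take j u)
                < below N (c j) + N (c j).
  rewrite leq_addr ltn_add2l -cu -{2}(cat_take_drop j u) count_cat.
  by rewrite (drop_nth ord0) ?su // /= eqxx addnCA leq_addr.
have lt j : below N (c j) + count_mem (c j) (take j u) < m.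
  by case/andP: (bound j) => _ /leq_trans; apply; exact: below_le.
pose s j : 'I_m := Ordinal (lt j).
have cs j : col (s j) = c j by apply: col_interval; apply: bound.
have smono i j : i < j -> c i = c j -> s i < s j.
  move=> ij e; rewrite /= e ltn_add2l -[in ltnRHS](cat_take_drop i.+1 (take j u)).
  rewrite take_takel // count_cat (take_nth ord0) ?su // -cats1 count_cat /=.
  by rewrite -/(c i) e eqxx addn0 addn1 leq_addr.
have sinj : injective s.
  move=> i j e; have ec : c i = c j by rewrite -!cs e.
  have [h|h|/val_inj//] := ltngtP i j.
    by have := smono _ _ h ec; rewrite e ltnn.
  by have := smono _ _ h (esym ec); rewrite e ltnn.
exists (perm sinj).
  by apply/linextP => i j ij; rewrite !permE !cs; apply: smono.
apply: (@eq_from_nth _ ord0); rewrite size_pword ?su // => i im.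
by rewrite -[i]/(nat_of_ord (Ordinal im)) nth_pword permE cs.
Qed.

Lemma perm_pword :
  perm_eq [seq pword p | p <- enum [set p | linext_rel r p]] (words N (weight N)).
Proof.
apply: uniq_perm; rewrite ?words_uniq //.
  rewrite map_inj_in_uniq ?enum_uniq // => p q; rewrite !mem_enum !inE.
  exact: pword_inj.
move=> u; apply/mapP/idP => [[p _ ->]|/pword_surj[p Lp <-]]; first exact: pword_words.
by exists p; rewrite // mem_enum inE.
Qed.

(** Position [j] is the number of equal letters before it plus the number of different ones, while
    [p j] is the first number plus [below N (col (p j))]. *)
Lemma derangement_avoid p : linext_rel r p ->
  poset_derangement r p = avoid K.+1 N (pword p).
Proof.
move=> Lp; rewrite /poset_derangement Lp /=.
have key j : (p j == j) = (count (predC1 (col (p j))) (take j (pword p)) == below N (col (p j))).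
  rewrite -(inj_eq val_inj) /= linext_rank //; set c := col (p j).
  have e : count_mem c (take j (pword p)) + count (predC1 c) (take j (pword p)) = j.
    by rewrite count_predC size_takel // size_pword ltnW.
  by rewrite -[X in _ == X]e addnC eqn_add2l eq_sym.
apply/forallP/forallP => [H c|H j].
  apply/implyP => _; apply/negP => /(hasfixP _ _ _ ord0)[j jm].
  rewrite size_pword in jm; rewrite -[j]/(nat_of_ord (Ordinal jm)) nth_pword.
  by move=> /andP[/eqP e E]; have := H (Ordinal jm); rewrite key e E.
rewrite key; apply/negP => E; have := H (col (p j)); rewrite ltn_ord /= => /negP; apply.
by apply/(hasfixP _ _ _ ord0); exists j; rewrite ?size_pword // nth_pword eqxx.
Qed.

Lemma card_derangements : #|[set p | poset_derangement r p]| = der N.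
Proof.
rewrite /der /avoiders -(perm_size (perm_filter _ perm_pword)) filter_map size_map.
rewrite cardE -(size_map id) map_id; apply: perm_size; apply: uniq_perm.
- exact: enum_uniq.
- by rewrite filter_uniq ?enum_uniq.
move=> p; rewrite mem_enum [RHS]mem_filter mem_enum !inE /=.
case Lp: (linext_rel r p); first by rewrite derangement_avoid ?Lp ?andbT.
by rewrite andbF /poset_derangement Lp.
Qed.

End LinearExtensions.

(** * The promotion graph *)

Section ChainColours.
Local Open Scope nat_scope.
Variable ns : seq nat.
Local Notation n := (sumn ns).
Local Notation K := (size ns).

Lemma chain_start_mono i j : i <= j -> chain_start ns i <= chain_start ns j.
Proof.
move=> ij; rewrite /chain_start -(subnKC ij) takeD sumn_cat; exact: leq_addr.
Qed.

(** Counting the chains that end at or before [x] gives the right index even when some chains are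
    empty. *)
Definition chain_index (x : nat) : nat := count (fun i => chain_start ns i.+1 <= x) (iota 0 K).

Lemma in_chain_index i x : i < K -> in_chain ns i x -> chain_index x = i.
Proof.
move=> iK /andP[ge lt]; rewrite /chain_index -(subnKC (ltnW iK)) iotaD count_cat.
rewrite (@eq_in_count _ _ predT) => [|l]; last first.
  by rewrite mem_iota => /andP[_ lj]; apply: leq_trans (chain_start_mono lj) ge.
rewrite count_predT size_iota (@eq_in_count _ _ pred0) ?count_pred0 ?addn0 // => l.
rewrite mem_iota => /andP[jl _]; apply/negbTE; rewrite -ltnNge.
by apply: leq_trans lt (chain_start_mono _).
Qed.

Lemma in_chain_ex x : x < n -> exists2 i, i < K & in_chain ns i x.
Proof.
move=> xn.
have exP : exists l, x < chain_start ns l by exists K; rewrite /chain_start take_size.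
case: (ex_minnP exP) => -[|l] xl minl; first by rewrite /chain_start take0 in xl.
have lx : chain_start ns l <= x by rewrite leqNgt; apply/negP => /minl; rewrite ltnn.
exists l; last by rewrite /in_chain lx.
rewrite ltnNge; apply: contraL xn => Kl; rewrite -leqNgt.
by apply: leq_trans lx; rewrite /chain_start take_oversize.
Qed.

Lemma chain_index_lt x : x < n -> chain_index x < K.
Proof. by move=> /in_chain_ex[i iK ix]; rewrite (in_chain_index iK ix). Qed.

Lemma in_chainE i x : i < K -> x < n -> in_chain ns i x = (chain_index x == i).
Proof.
move=> iK /in_chain_ex[l lK lx]; apply/idP/eqP => [|xi]; first exact: in_chain_index.
by rewrite -xi (in_chain_index lK).
Qed.

Definition colour (x : 'I_n) : 'I_K.+1 := inord (chain_index x).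

Lemma val_colour x : colour x = chain_index x :> nat.
Proof. by rewrite inordK // -[K](size_iota 0) ltnS count_size. Qed.

Lemma colour_mono (a b : 'I_n) : a <= b -> colour a <= colour b.
Proof.
by move=> ab; rewrite !val_colour; apply: sub_count => i /= /leq_trans; apply.
Qed.

Lemma precE (x y : 'I_n) : prec x y = (colour x == colour y) && (x < y).
Proof.
rewrite /prec; congr (_ && _); rewrite -(inj_eq val_inj) /= !val_colour.
apply/hasP/eqP => [[i]|e].
  by rewrite mem_iota => /andP[_ iK]; rewrite !in_chainE // => /andP[/eqP -> /eqP ->].
exists (chain_index x); first by rewrite mem_iota chain_index_lt.
by rewrite !in_chainE ?chain_index_lt // -e eqxx.
Qed.

Lemma comparableE (x y : 'I_n) : Defs.comparable x y = (colour x == colour y) && (x != y).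
Proof.
rewrite /Defs.comparable !precE [colour y == _]eq_sym -andb_orr -neq_ltn.
by rewrite (inj_eq val_inj).
Qed.

Definition content m (col : 'I_m -> 'I_K.+1) : {ffun 'I_K.+1 -> 'I_n.+1} :=
  [ffun c => inord #|[pred a | col a == c]|].

Lemma contentE m (col : 'I_m -> 'I_K.+1) c : m <= n ->
  #|[pred a | col a == c]| = content col c.
Proof.
move=> mn; rewrite ffunE inordK // ltnS (leq_trans (max_card _)) //.
by rewrite card_ord.
Qed.

(** When the two elements are comparable [tau] does nothing, but then their letters agree. On words
    it is thus always a swap of two positions. *)
Lemma nth_tau (p : 'S_n) k l : k.+1 < n ->
  nth ord0 (pword colour (tau k p)) l =
  nth ord0 (pword colour p) (if l == k then k.+1 else if l == k.+1 then k else l).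
Proof.
move=> kn; rewrite /tau insubT ?(ltnW kn) // => kn'; rewrite insubT /=.
set a : 'I_n := Sub k _; set b : 'I_n := Sub k.+1 _.
have [ln|nl] := ltnP l n; last first.
  have -> : (l == k) = false by apply/eqP; lia.
  have -> : (l == k.+1) = false by apply/eqP; lia.
  by rewrite !nth_default ?size_pword.
pose t := tperm a b (Ordinal ln).
have -> : (if l == k then k.+1 else if l == k.+1 then k else l) = t.
  rewrite /t; case: tpermP => [[->]|[->]|la lb]; rewrite ?eqxx ?(gtn_eqF (ltnSn k)) //.
  have -> : (l == k) = false by apply/eqP => lk; apply: la; apply: val_inj.
  by have -> : (l == k.+1) = false by apply/eqP => lk; apply: lb; apply: val_inj.
rewrite -[l in LHS]/(nat_of_ord (Ordinal ln)) !nth_pword.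
case: ifP; last by rewrite permM.
rewrite comparableE => /andP[/eqP e _]; rewrite /t.
by case: tpermP => [->|->|].
Qed.

Lemma tau_linext (p : 'S_n) k : linext_rel (@prec ns) p -> linext_rel (@prec ns) (tau k p).
Proof.
move=> Lp; rewrite /tau; case: insubP => // a _ ak; case: insubP => // b _ bk.
case: ifPn => // ncomp; apply/forallP => x; apply/forallP => y; apply/implyP => xy.
have := Lp => /forallP/(_ x)/forallP/(_ y)/implyP/(_ xy).
rewrite invMg tpermV !permM; set u := (p^-1 x)%g; set v := (p^-1 y)%g => uv.
have [ux vy] : p u = x /\ p v = y by rewrite !permKV.
have ab : b = a.+1 :> nat by rewrite bk -ak.
have tE (z : 'I_n) : tperm a b z = (if z == a :> nat then nat_of_ord b else
    if z == b :> nat then nat_of_ord a else z) :> nat.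
  by case: tpermP => [->|->|/eqP za /eqP zb]; rewrite ?eqxx ?ifN // ab gtn_eqF.
have nab : u == a :> nat -> v == b :> nat -> False.
  move=> /eqP/val_inj ua /eqP/val_inj vb; case/negP: ncomp.
  by rewrite /Defs.comparable -ua -vb ux vy xy.
rewrite !tE; move: nab uv; rewrite ab.
case: eqP => ua; case: eqP => va; try (case: eqP => ub); try (case: eqP => vb) => nab uv;
  try lia; by case: nab.
Qed.

Lemma promo_linext (p : 'S_n) j : linext_rel (@prec ns) p -> linext_rel (@prec ns) (promo j p).
Proof.
rewrite /promo; elim: (iota _ _) p => //= k s IH p Lp; exact/IH/tau_linext.
Qed.

Lemma nth_promo (p : 'S_n) (j : 'I_n) l : l < n ->
  nth ord0 (pword colour (promo j p)) l =
  nth ord0 (pword colour p) (if l < j then l else if l == n.-1 then nat_of_ord j else l.+1).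
Proof.
move=> ln.
(* After [i] swaps the letter from position [j] has reached [j + i], and those it passed have
   shifted left. *)
have H i : j + i <= n.-1 ->
  nth ord0 (pword colour (foldl (fun q k => tau k q) p (iota j i))) =1
  fun l => nth ord0 (pword colour p)
    (if l < j then l else if l < j + i then l.+1 else if l == j + i then nat_of_ord j else l).
  elim: i => [|i IH] ji l'.
    by rewrite /= addn0; case: ltngtP => // ->.
  rewrite -{1}[i.+1]addn1 iotaD foldl_cat /= nth_tau; last by lia.
  rewrite IH; last by lia.
  congr (nth _ _ _); case: (l' =P j + i) => [->|?]; try (case: (l' =P (j + i).+1) => [->|?]);
    repeat (let H := fresh in case: ifP => H); lia.
rewrite /promo H; last by have := ltn_ord j; lia.
have jn := ltn_ord j; congr (nth _ _ _); case: ltnP => // jl.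
have -> : j + (n.-1 - j) = n.-1 by lia.
by case: eqP => [->|ne]; [rewrite ltnn|rewrite ifT //; lia].
Qed.

Lemma step_pword (p : 'S_n) (j : 'I_n) :
  step (rev (pword colour p)) (rev_ord j) = rev (pword colour (promo j p)).
Proof.
have jn := ltn_ord j; set w := pword colour p.
have sw : size w = n by exact: size_pword.
have -> : pword colour (promo j p) = rcons (take j w ++ drop j.+1 w) (nth ord0 w j).
  apply: (@eq_from_nth _ ord0).
    by rewrite size_rcons size_cat size_drop size_takel size_pword ?sw; lia.
  move=> l; rewrite size_pword => ln; rewrite nth_promo // -/w.
  rewrite nth_rcons nth_cat size_cat size_drop size_takel ?sw; last by lia.
  case: ltnP => lj; first by rewrite ifT ?nth_take //; lia.
  case: eqP => [->|ne]; first by rewrite ifF ?ifT //; lia.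
  by rewrite ifT ?nth_drop; [congr nth|]; lia.
rewrite /step nth_rev ?sw /=; last by lia.
rewrite rev_rcons rev_cat take_rev drop_rev sw.
congr (nth _ _ _ :: rev (drop _ _) ++ rev (take _ _)); lia.
Qed.

End ChainColours.

(** * Lower sets, their contents and their restrictions *)

Section Restriction.
Local Open Scope nat_scope.
Variable ns : seq nat.
Local Notation n := (sumn ns).
Local Notation K := (size ns).
Implicit Types (S : {set 'I_n}) (c : 'I_K.+1).

(** The enumeration of [S] is increasing, hence inverse to the order-preserving relabelling. *)
Lemma enum_val_lt S (a b : 'I_#|S|) : (enum_val a < enum_val b) = (a < b).
Proof.
have mono (i j : 'I_#|S|) : i < j -> enum_val i < enum_val j.
  move=> ij; have x0 : 'I_n := enum_val i; rewrite (enum_val_nth x0 i) (enum_val_nth x0 j).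
  have sorted_S : sorted (fun x y : 'I_n => x < y) (enum S).
    rewrite {1}/enum_mem; apply: sorted_filter => [x y z|]; first exact: ltn_trans.
    by have := iota_ltn_sorted 0 n; rewrite -val_enum_ord sorted_map enumT.
  apply: (sorted_ltn_nth _ _ sorted_S); rewrite ?inE -?cardE //.
  by move=> x y z; apply: ltn_trans.
have [lt|lt|/val_inj ->] := ltngtP a b; last by rewrite ltnn.
  exact: mono.
by apply/negbTE; rewrite -leqNgt ltnW // mono.
Qed.

Lemma relabel_enum_val S (a : 'I_#|S|) : relabel S (enum_val a) = a.
Proof.
rewrite /relabel -[RHS](card_ord_lt (ltnW (ltn_ord a))) -(card_imset _ (@enum_val_inj _ (mem S))).
apply: eq_card => x; rewrite !inE; apply/andP/imsetP => [[xS lt]|[b]].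
  exists (enum_rank_in xS x); last by rewrite enum_rankK_in.
  by rewrite inE -enum_val_lt enum_rankK_in.
by rewrite inE => ba ->; rewrite enum_val_lt ba enum_valP.
Qed.

Lemma restr_relE S (a b : 'I_#|S|) :
  restr_rel a b = (colour (enum_val a) == colour (enum_val b)) && (a < b).
Proof.
rewrite -enum_val_lt -precE; apply/existsP/idP => [[x /existsP[y]]|ab].
  case/and5P=> xS yS; rewrite -(enum_rankK_in xS xS) -(enum_rankK_in yS yS).
  by rewrite !relabel_enum_val => /eqP/val_inj -> /eqP/val_inj ->.
exists (enum_val a); apply/existsP; exists (enum_val b).
by rewrite !enum_valP !relabel_enum_val !eqxx.
Qed.

Lemma dS_der S : dS S = der (content (fun a : 'I_#|S| => colour (enum_val a))).
Proof.
apply: (@card_derangements _ _ _ _ (fun a : 'I_#|S| => colour (enum_val a))).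
- move=> a b ab; apply: colour_mono.
  by rewrite leqNgt enum_val_lt -leqNgt.
- exact: restr_relE.
- by move=> c; apply: contentE; apply: leq_trans (max_card _) _; rewrite card_ord.
Qed.

Lemma content_restr S c :
  content (fun a : 'I_#|S| => colour (enum_val a)) c = #|[set i in S | colour i == c]| :> nat.
Proof.
rewrite -contentE; last by apply: leq_trans (max_card _) _; rewrite card_ord.
rewrite -(card_imset _ (@enum_val_inj _ (mem S))); apply: eq_card => x; rewrite !inE.
apply/imsetP/andP => [[a]|[xS xc]]; first by rewrite inE => ac ->; rewrite enum_valP.
by exists (enum_rank_in xS x); rewrite ?inE enum_rankK_in.
Qed.

Local Notation N := (content (@colour ns)).

Lemma card_colour c : #|[pred a : 'I_n | colour a == c]| = N c.
Proof. exact: contentE. Qed.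

(** [U] counts the elements left out at the top of each chain. *)
Definition lower_of (U : {ffun 'I_K.+1 -> 'I_n.+1}) : {set 'I_n} :=
  [set i : 'I_n | i < below N (colour i) + (N (colour i) - U (colour i))].

Definition vec_of S : {ffun 'I_K.+1 -> 'I_n.+1} :=
  [ffun c => inord (N c - #|[set i in S | colour i == c]|)].

Lemma lower_set_of U : lower_set (lower_of U).
Proof.
apply/forallP => x; apply/forallP => y; apply/implyP => /andP[].
rewrite precE !inE => /andP[/eqP -> lt]; exact: ltn_trans.
Qed.

Lemma card_lower_of U c : lev U N -> #|[set i in lower_of U | colour i == c]| = N c - U c.
Proof.
move=> /levP/(_ c) UN; set x := N c - U c.
have xN : x <= N c by rewrite leq_subr.
have bn := below_le card_colour c.
(* Adding [below N c] reduces the count to the sizes of two initial segments of labels, ending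
   before [below N c] and before [below N c + x]. *)
apply/eqP; rewrite -(eqn_add2l (below N c)).
rewrite -[X in _ == X](@card_ord_lt n); last by apply: leq_trans bn; rewrite leq_add2l.
rewrite -[X in X + _ == _](@card_ord_lt n); last by apply: leq_trans bn; rewrite leq_addr.
rewrite -[X in _ == X](cardID [pred i : 'I_n | i < below N c]); apply/eqP; congr (_ + _).
  apply: eq_card => i; rewrite !inE.
  case: (ltnP i (below N c)) => h; rewrite ?andbF //.
  by rewrite andbT (leq_trans h) ?leq_addr.
apply: eq_card => i; rewrite !inE -leqNgt; apply/andP/andP => [[lt /eqP ic]|[ge lt]].
  by rewrite ic in lt; rewrite lt {1}(rankE (@colour_mono ns) card_colour i) ic leq_addr.
have ic : colour i = c.
  apply: (col_interval (@colour_mono ns) card_colour); rewrite ge /=.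
  by apply: leq_trans lt _; rewrite leq_add2l.
by rewrite ic eqxx.
Qed.

(** A lower set meets each chain in an initial segment, which is determined by its size. *)
Lemma lower_ofK S : lower_set S -> lower_of (vec_of S) = S.
Proof.
move=> /forallP H; apply/setP => i; rewrite inE [vec_of _ _]ffunE.
set c := colour i; set s := #|_|.
have sN : s <= N c.
  by rewrite -card_colour; apply: subset_leq_card; apply/subsetP => x; rewrite !inE => /andP[].
rewrite inordK; last by apply: leq_ltn_trans (leq_subr _ _) (ltn_ord _).
rewrite subKn // [X in X < _](rankE (@colour_mono ns) card_colour i) ltn_add2l.
case iS: (i \in S).
  apply: proper_card; apply/properP; split.
    apply/subsetP => x; rewrite !inE => /andP[xi xc]; rewrite xc andbT.
    by have /forallP/(_ x)/implyP := H i; apply; rewrite precE xc xi.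
  by exists i; rewrite !inE ?iS ?eqxx // ltnn.
apply/negbTE; rewrite -leqNgt; apply: subset_leq_card; apply/subsetP => x.
rewrite !inE => /andP[xS xc]; rewrite xc andbT ltnNge leq_eqVlt.
apply: contraFN iS => /orP[/eqP/val_inj ->//|ix].
by have /forallP/(_ i)/implyP := H x; apply; rewrite precE [colour i == _]eq_sym xc ix.
Qed.

Lemma vec_ofK U : (vec_of (lower_of U) == U) = lev U N.
Proof.
apply/eqP/idP => [<-|UN].
  apply/levP => c; rewrite [vec_of _ _]ffunE inordK ?leq_subr //.
  by apply: leq_ltn_trans (leq_subr _ _) (ltn_ord _).
apply/ffunP => c; apply/val_inj; rewrite /= [vec_of _ _]ffunE card_lower_of // subKn; last exact/levP.
by rewrite inord_val.
Qed.

Lemma dS_lower_of U : lev U N -> dS (lower_of U) = der (subv N U).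
Proof.
move=> UN; rewrite dS_der; congr der; apply/ffunP => c; apply/val_inj.
by rewrite /= content_restr card_lower_of // [subv _ _ _]ffunE.
Qed.

(** The empty permutation is vacuously a derangement; this supplies the isolated factor ['X] of the
    theorem. *)
Lemma dS0 : dS (set0 : {set 'I_n}) = 1.
Proof.
transitivity #|{perm 'I_#|(set0 : {set 'I_n})|}|; last first.
  by rewrite card_Sn cards0.
apply: eq_card => p; rewrite !inE /poset_derangement.
by apply/andP; split; apply/forallP => i; have := valP (enum_val i); have := enum_valP i; rewrite inE.
Qed.

End Restriction.

(** * The transition matrix as a move-to-front operator *)

Lemma polyX_shift (R : nzRingType) (A G : R) (b : bool) :
  'X *+ b - (G - A *+ b)%:P = ('X + A%:P) *+ b - G%:P.
Proof. by rewrite polyCB polyCMn mulrnDl opprB addrA. Qed.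

Section Main.
Variable ns : seq nat.
Local Notation n := (sumn ns).
Local Notation K := (size ns).
Local Notation N := (content (@colour ns)).

(** Extended by 0 to all naturals, so that intervals of labels can be summed over [nat]. *)
Definition gen (k : nat) : {mpoly int[n]} := oapp (fun i : 'I_n => 'X_i) 0 (insub k).

(* The occurrence of [c] of index [t] from the end of the one-line notation is the
   element of label [below N c + (N c - 1 - t)]. *)
Definition occ_gen (c : 'I_K.+1) (t : nat) : {poly {mpoly int[n]}} :=
  (gen (below N c + (N c).-1 - t))%:P.

(** The moves from any linear extension, loops included, have total weight the sum of all ['X_i],
    which is absorbed into the spectral parameter. *)
Definition shifted : {poly {mpoly int[n]}} := 'X + (\sum_(i < n) 'X_i)%:P.

Lemma gen_ord (i : 'I_n) : gen i = 'X_i.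
Proof. by rewrite /gen valK. Qed.

Lemma occ_weight_rev (p : 'S_n) (j : 'I_n) : linext_rel (@prec ns) p ->
  occ_weight occ_gen (rev (pword (@colour ns) p)) (rev_ord j) = ('X_(p j))%:P.
Proof.
move=> Lp; have jn := ltn_ord j; have sw := size_pword (@colour ns) p.
rewrite /occ_weight nth_rev sw /=; last by lia.
have -> : (n - (n - j.+1).+1 = j)%N by lia.
rewrite nth_pword take_rev sw /occ_gen -gen_ord count_rev.
have -> : (n - (n - j.+1) = j.+1)%N by lia.
have E := linext_rank (@colour_mono ns) (@precE ns) (@card_colour ns) j Lp.
congr (gen _)%:P; rewrite E.
have := count_pword (@card_colour ns) p (colour (p j)).
rewrite -{1}(cat_take_drop j (pword _ p)) (drop_nth ord0) ?sw // nth_pword count_cat /= eqxx.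
by move=> <-; lia.
Qed.

(** Loops are added to both the incoming and the outgoing weight; they cancel, and the outgoing
    total becomes the same for every [p]. *)
Lemma trans_entryE (p p' : 'S_n) :
  trans_entry p' p = \sum_(j : 'I_n | promo j p == p') 'X_(p j) - (\sum_i 'X_i) *+ (p' == p).
Proof.
rewrite /trans_entry; have [->|_] /= := eqVneq p' p; last by rewrite mulr0n subr0.
rewrite mulr1n [X in _ = _ - X](reindex_inj (@perm_inj _ p)) /=.
by rewrite [X in _ = _ - X](bigID (fun j : 'I_n => promo j p == p)) /= opprD addrA subrr add0r.
Qed.

Lemma char_entry (p p' : 'S_n) :
  linext_rel (@prec ns) p -> linext_rel (@prec ns) p' ->
  'X *+ (p' == p) - (trans_entry p' p)%:P =
  shifted *+ (rev (pword (@colour ns) p) == rev (pword (@colour ns) p'))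
    - mtf occ_gen (rev (pword (@colour ns) p)) (rev (pword (@colour ns) p')).
Proof.
move=> Lp Lp'.
have wE q : linext_rel (@prec ns) q ->
    (rev (pword (@colour ns) q) == rev (pword (@colour ns) p')) = (q == p').
  move=> Lq; rewrite (inj_eq (can_inj revK)); apply/eqP/eqP => [|->//].
  by apply: (pword_inj (@colour_mono ns) (@precE ns) (@card_colour ns)); rewrite inE.
have -> : mtf occ_gen (rev (pword (@colour ns) p)) (rev (pword (@colour ns) p')) =
    (\sum_(j : 'I_n | promo j p == p') 'X_(p j))%:P.
  rewrite /mtf size_rev size_pword (reindex_inj rev_ord_inj) rmorph_sum [RHS]big_mkcond /=.
  apply: eq_bigr => j _; rewrite step_pword wE; last exact: promo_linext.
  by rewrite (occ_weight_rev _ Lp); rewrite mulr_natr mulrb.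
rewrite trans_entryE wE; last exact: Lp.
rewrite [p == p']eq_sym.
exact: polyX_shift.
Qed.

Lemma char_poly_charS :
  char_poly (transM ns) = charS shifted (words N (weight N)) (mtf occ_gen).
Proof.
rewrite /char_poly.
transitivity (detS (enum (linexts ns))
   (fun p' p => 'X *+ (p' == p) - (trans_entry p' p)%:P)).
  rewrite -(mxS_cast (esym (cardE (mem (linexts ns)))) 1%g); congr (\det _).
  apply/matrixP => a b; rewrite !mxE -!(enum_val_nth 1%g).
  by rewrite (inj_eq enum_val_inj).
(* [mtf] takes the source first, whereas [transM] has the target as row. *)
rewrite detS_tr /charS.
transitivity (detS [seq rev u | u <- [seq pword (@colour ns) p | p <- enum (linexts ns)]]
   (fun x z => shifted *+ (x == z) - mtf occ_gen x z)).
  rewrite !detS_map; apply: eq_detS => p p'; rewrite !mem_enum !inE => Lp Lp'.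
  exact: char_entry.
apply: detS_perm; apply: perm_trans (perm_map _ _) _.
  exact: (perm_pword (@colour_mono ns) (@precE ns) (@card_colour ns)).
apply: uniq_perm; rewrite ?words_uniq // ?(map_inj_uniq (can_inj revK)) ?words_uniq // => u.
rewrite -{1}(revK u) (mem_map (can_inj revK)).
by apply: perm_words; rewrite perm_rev.
Qed.

(** The occurrences of [c] of index below [U c], counted from the end, are the top [U c] elements of
    the chain, exactly those outside [lower_of U]. *)
Lemma sumv_lower_of U : lev U N ->
  shifted - sumv occ_gen U = 'X + (xS (lower_of U))%:P.
Proof.
move=> UN.
have -> : sumv occ_gen U = (\sum_(i | i \notin lower_of U) 'X_i)%:P; last first.
  rewrite /shifted /xS (bigID (mem (lower_of U))) /= rmorphD /=; ring.
rewrite /sumv (partition_big (@colour ns) predT) //= rmorph_sum; apply: eq_bigr => c _ /=.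
rewrite -rmorph_sum; congr polyC.
have Uc := levP _ _ UN c; set b := (below N c)%N.
have bn : (b + N c <= n)%N := below_le (@card_colour ns) c.
transitivity (\sum_(0 + (b + N c - U c) <= k < b + N c) gen k).
  rewrite big_nat_rev [RHS]big_addn.
  have -> : (b + N c - (b + N c - U c) = U c)%N by lia.
  by rewrite !big_nat; apply: eq_bigr => t ht; congr gen; lia.
rewrite add0n (big_nat_widen _ _ n) // big_geq_mkord.
apply: eq_big => [i|i _]; last exact: gen_ord.
rewrite inE -leqNgt; apply/andP/andP => [[/= lt ge]|[ge /eqP ic]].
  have ic : colour i = c.
    apply: (col_interval (@colour_mono ns) (@card_colour ns)); rewrite lt andbT.
    by apply: leq_trans ge; rewrite -/b; lia.
  rewrite ic eqxx -/b; split=> //; move: ge Uc; rewrite -/b; lia.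
rewrite ic -/b in ge; split; last by move: ge Uc; lia.
by have := rank_bound (@colour_mono ns) (@card_colour ns) i; rewrite ic.
Qed.

(** [sumv] is a constant, so the difference is monic of degree 1 in ['X]. *)
Lemma shifted_neq0 U : shifted - sumv (B := n) occ_gen U != 0.
Proof.
have [s ->] : exists s, sumv occ_gen U = s%:P.
  exists (\sum_c \sum_(0 <= t < U c) gen (below N c + (N c).-1 - t)).
  by rewrite rmorph_sum; apply: eq_bigr => c _; rewrite rmorph_sum.
by rewrite /shifted -addrA -polyCB -[X in 'X + X]opprK -polyCN polyXsubC_eq0.
Qed.

End Main.

Theorem theorem5p4 (ns : seq nat) :
  char_poly (transM ns) =
  'X * \prod_(S : {set 'I_(sumn ns)} | lower_set S && (S != set0))
         ('X + (xS S)%:P) ^+ dS S.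
Proof.
rewrite char_poly_charS chi_prod; last exact: shifted_neq0.
transitivity (\prod_(S : {set 'I_(sumn ns)} | lower_set S) ('X + (xS S)%:P) ^+ dS S).
  rewrite [RHS](reindex_onto (@lower_of ns) (@vec_of ns)) /=; last exact: lower_ofK.
  apply: eq_big => U; first by rewrite vec_ofK lower_set_of.
  by move=> UN; rewrite sumv_lower_of // dS_lower_of.
(* The empty lower set contributes the factor ['X]. *)
rewrite (bigD1 set0) /=; last first.
  by apply/forallP => x; apply/forallP => y; rewrite inE andbF.
by congr (_ * _); rewrite dS0 expr1 /xS big_set0 polyC0 addr0.
Qed.
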